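(* Let $(S, +)$ be a commutative semigroup, let $(S, \times)$ be a semigroup (on the same underlying set $S$), and let $\sigma, \tau \in \operatorname{Sym}(S)$. Then there exists $\phi \in \operatorname{Aut}(S, +)$ that is a semigroup isomorphism from $(S, \times^{\sigma})$ to $(S, \times^{\tau})$ if and only if $\sigma$ and $\tau$ belong to the same double coset in $\operatorname{Aut}(S, \times) \backslash \operatorname{Sym}(S) / \operatorname{Aut}(S, +)$.
   Context: Mappings are written to the right of their arguments and composed from left to right, so $(x)\sigma\tau = ((x)\sigma)\tau$. $\operatorname{Sym}(S)$ denotes the symmetric group on the set $S$ (all bijections $S \to S$ under this composition). For a binary operation $\cdot : S \times S \to S$ and $\sigma \in \operatorname{Sym}(S)$, the binary operation $\cdot^{\sigma} : S \times S \to S$ is defined by $x \cdot^{\sigma} y = ((x)\sigma^{-1} \cdot (y)\sigma^{-1})\sigma$ for all $x, y \in S$ (if $\cdot$ is associative, so is $\cdot^{\sigma}$). A semigroup isomorphism from $(S, \times)$ to $(T, \otimes)$ is a bijection $\phi : S \to T$ with $(x \times y)\phi = (x)\phi \otimes (y)\phi$ for all $x, y \in S$. $\operatorname{Aut}(S, \times)$ denotes the group of all semigroup isomorphisms from $(S, \times)$ to itself, and similarly for $\operatorname{Aut}(S,+)$. For subgroups $H, K$ of a group $G$, the double cosets $H \backslash G / K$ are the sets of the form $\{hgk \mid h \in H, k \in K\}$ for $g \in G$, where products in $\operatorname{Sym}(S)$ are compositions from left to right. *)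

(* Defs.v *)
From HB Require Import structures.
From mathcomp Require Import all_boot.
From mathcomp Require Import boolp classical_sets.

Set Implicit Arguments.
Unset Strict Implicit.
Unset Printing Implicit Defensive.

Local Open Scope classical_set_scope.

(* The inverse is stored as data so that it can be computed with; it is
   determined by the underlying function (see [Sym_ext]), and every bijection
   occurs (see [Sym_of_bijective]). *)
Record Sym (S : Type) := MkSym {
  Sym_fun :> S -> S;
  Sym_inv : S -> S;
  Sym_funK : cancel Sym_fun Sym_inv;
  Sym_invK : cancel Sym_inv Sym_fun
}.

Lemma Sym_ext (S : Type) (s t : Sym S) : s =1 t -> s = t.
Proof.
case: s t => [f f' fK f'K] [g g' gK g'K] /= /funext fg; subst g.
have f'g' : f' = g' by apply: funext => x; rewrite -[in LHS](g'K x) fK.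
by subst g'; congr MkSym; apply: Prop_irrelevance.
Qed.

Lemma Sym_of_bijective (S : Type) (f : S -> S) :
  bijective f -> exists s : Sym S, s =1 f.
Proof. by case=> g fK gK; exists (MkSym fK gK). Qed.

Lemma Sym_bij (S : Type) (s : Sym S) : bijective s.
Proof. by exists (Sym_inv s); [apply: Sym_funK | apply: Sym_invK]. Qed.

HB.instance Definition _ (S : Type) := gen_eqMixin (Sym S).
HB.instance Definition _ (S : Type) := gen_choiceMixin (Sym S).

Section SymGroup.
Variable S : Type.
Implicit Types s t u : Sym S.

Definition Sym_one : Sym S :=
  @MkSym S id id (fun=> erefl) (fun=> erefl).

(* Left-to-right composition: first s, then t. *)
Definition Sym_mul s t : Sym S :=
  MkSym (can_comp (Sym_funK t) (Sym_funK s))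
        (can_comp (Sym_invK s) (Sym_invK t)).

Definition Sym_invg s : Sym S := MkSym (Sym_invK s) (Sym_funK s).

Lemma Sym_mulA : associative Sym_mul.
Proof. by move=> s t u; apply: Sym_ext. Qed.

Lemma Sym_mul1 : left_id Sym_one Sym_mul.
Proof. by move=> s; apply: Sym_ext. Qed.

Lemma Sym_mulr1 : right_id Sym_one Sym_mul.
Proof. by move=> s; apply: Sym_ext. Qed.

Lemma Sym_mulV : left_inverse Sym_one Sym_invg Sym_mul.
Proof. by move=> s; apply: Sym_ext => x /=; rewrite Sym_invK. Qed.

Lemma Sym_mulrV : right_inverse Sym_one Sym_invg Sym_mul.
Proof. by move=> s; apply: Sym_ext => x /=; rewrite Sym_funK. Qed.

HB.instance Definition _ := isGroup.Build (Sym S)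
  Sym_mulA Sym_mul1 Sym_mulr1 Sym_mulV Sym_mulrV.

End SymGroup.

Lemma SymM (S : Type) (s t : Sym S) (x : S) : (s * t)%g x = t (s x).
Proof. by []. Qed.

Definition semigroup_iso (S T : Type) (mulS : S -> S -> S) (mulT : T -> T -> T)
    (phi : S -> T) : Prop :=
  bijective phi /\ {morph phi : x y / mulS x y >-> mulT x y}.

Definition Aut (S : Type) (op : S -> S -> S) : set (Sym S) :=
  [set s | semigroup_iso op op s].

Lemma Aut_group_closed (S : Type) (op : S -> S -> S) :
  group_closed (mem (Aut op)).
Proof.
split; first by rewrite inE; split=> //; apply: Sym_bij.
move=> s t; rewrite !inE => -[_ sM] [_ tM]; split; first exact: Sym_bij.
move=> x y /=; rewrite sM; apply: (can_inj (Sym_funK t)).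
by rewrite tM !Sym_invK.
Qed.

Definition conj_op (S : Type) (op : S -> S -> S) (s : Sym S) : S -> S -> S :=
  fun x y => s (op ((s^-1)%g x) ((s^-1)%g y)).

Lemma conj_opA (S : Type) (op : S -> S -> S) (s : Sym S) :
  associative op -> associative (conj_op op s).
Proof. by move=> opA x y z; rewrite /conj_op /= !Sym_funK opA. Qed.

Definition double_coset (G : groupType) (H K : set G) (g : G) : set G :=
  [set x | exists h k, [/\ H h, K k & x = (h * g * k)%g]].

Definition double_cosets (G : groupType) (H K : set G) : set (set G) :=
  [set D | exists g : G, D = double_coset H K g].

(* Main.v *)
Require Import Defs.
From mathcomp Require Import all_boot.
From mathcomp Require Import boolp classical_sets.

(** Both the multiplication transported along [s] and the one transported
    along [t] are copies of the same operation, through [s] and [t].  Hence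
    [phi] is an isomorphism from the first copy to the second exactly when
    [s * phi * t^-1], which pulls [phi] back along these copies, is an
    automorphism of the original operation ([semigroup_iso_conj_op]).

    After this, the theorem is a computation in the group [Sym S], with
    [H = Aut mul] and [K = Aut add]: for subgroups [H] and [K], there is
    [phi] in [K] with [sigma * phi * tau^-1] in [H] if and only if [sigma] and
    [tau] lie in a common double coset ([double_coset_common]). *)

Local Open Scope group_scope.

Lemma semigroup_iso_conj_op (S : Type) (op : S -> S -> S) (s t phi : Sym S) :
  semigroup_iso (conj_op op s) (conj_op op t) phi <-> Aut op (s * phi * t^-1).
Proof.
split=> -[_ phiM]; split; try exact: Sym_bij; move=> x y /=.
  by have := phiM (s x) (s y); rewrite /conj_op /= !Sym_funK => ->;
     rewrite Sym_funK.
have /= := phiM (Sym_inv s x) (Sym_inv s y); rewrite !Sym_invK => E.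
by rewrite /conj_op /= -E Sym_invK.
Qed.

(** If [h = x * k * y^-1] then [x = h * y * k^-1], so the double coset of [y]
    serves; the closure of [K] under inverses is what puts [x] in it. *)
Lemma double_coset_common (G : groupType) (H K : set G) (x y : G) :
  group_closed (mem H) -> group_closed (mem K) ->
  (exists k, K k /\ H (x * k * y^-1)) <->
  (exists D, double_cosets H K D /\ D x /\ D y).
Proof.
move=> [/set_mem H1 HB] [/set_mem K1 KB].
have HdivP h h' : H h -> H h' -> H (h * h'^-1).
  by move=> Hh Hh'; apply/set_mem/HB; apply/mem_set.
have KdivP k k' : K k -> K k' -> K (k * k'^-1).
  by move=> Kk Kk'; apply/set_mem/KB; apply/mem_set.
have KV k : K k -> K k^-1 by move=> Kk; rewrite -[k^-1]mul1g; apply: KdivP.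
split=> [[k [Kk Hxky]] | [_ [[g ->] [[h [k [Hh Kk ->]]] [h' [k' [Hh' Kk' ->]]]]]]].
  exists (double_coset H K y); split; first by exists y.
  split; last by exists 1, 1; split; rewrite ?mul1g ?mulg1.
  by exists (x * k * y^-1), k^-1; split; [| exact: KV | rewrite mulgVK mulgK].
(* With this witness, x * _ * y^-1 is h * g * k * (k^-1 * k') * (h' * g * k')^-1,
   which collapses to h * h'^-1. *)
exists (k^-1 * k'); split.
  by rewrite -[k' in _ * k']invgK; apply: KdivP; apply: KV.
by rewrite !invgM !mulgA !mulgK; apply: HdivP.
Qed.

Theorem theorem1p3 (S : Type) (add mul : S -> S -> S)
    (addA : associative add) (addC : commutative add) (mulA : associative mul)
    (sigma tau : Sym S) :
  (exists phi : Sym S,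
     Aut add phi /\
     semigroup_iso (conj_op mul sigma) (conj_op mul tau) phi) <->
  (exists D : set (Sym S),
     double_cosets (Aut mul) (Aut add) D /\ D sigma /\ D tau).
Proof.
rewrite -double_coset_common; try exact: Aut_group_closed.
by split=> -[phi [Aphi isophi]]; exists phi; split=> //;
   apply/semigroup_iso_conj_op.
Qed.
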